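(* Let $G$ be a finite nilpotent group. Then $$\mathrm{girth}(\Gamma^*(G))=\begin{cases} \infty, & \text{if } G \cong \mathbb{Z}_{p^a} \text{ or } G\cong\mathbb{Z}_{p^aq}, \text{ where } a\geq 1,\\ 4, & \text{if } G \cong \mathbb{Z}_{p^aq^b}, \text{ where } a,b\geq 2,\\ 3, & \text{otherwise,} \end{cases}$$ where $p,q$ are distinct primes.
   Context: For a group $G$, the co-maximal subgroup graph $\Gamma(G)$ is the undirected graph whose vertices are the non-trivial proper subgroups of $G$, two distinct vertices $H,K$ being adjacent if and only if $HK=G$, where $HK=\{hk : h\in H, k\in K\}$. The deleted co-maximal subgroup graph $\Gamma^*(G)$ is the graph obtained by removing all isolated vertices from $\Gamma(G)$. The girth of a graph is the length of a smallest cycle in it, and is $\infty$ if there is no cycle. $\mathbb{Z}_n$ denotes the cyclic group of order $n$; $a$ and $b$ are integers.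
   Formalization: The group G is assumed non-trivial: for the trivial group the graph has no vertices, so its girth is ∞, whereas the statement as written would put it in the ''otherwise'' case with girth 3. *)

(* Defs.v *)
From HB Require Import structures.
From mathcomp Require Import all_boot all_fingroup all_algebra all_solvable.

Set Implicit Arguments.
Unset Strict Implicit.
Unset Printing Implicit Defensive.

Import GroupScope.

(* A simple graph whose vertex set is a subset of a finite type; the values
   of [adj] outside [vertices] are irrelevant. *)
Record sgraph (T : finType) := SGraph {
  vertices : {set T};
  adj : rel T;
  adj_sym : symmetric adj;
  adj_irrefl : irreflexive adj
}.

Section Girth.

Variables (T : finType) (Gr : sgraph T).

Definition del_isolated : sgraph T :=
  SGraph [set x in vertices Gr | [exists y in vertices Gr, adj Gr x y]]
         (@adj_sym T Gr) (@adj_irrefl T Gr).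

Definition is_cycle (c : seq T) : bool :=
  [&& 3 <= size c, all (mem (vertices Gr)) c & ucycleb (adj Gr) c].

(* Cycles are duplicate-free, so their length is at most #|T|, and the
   first length found in this range is the least one (see [girthP]).
   [None] stands for infinity. *)
Definition girth : option nat :=
  ohead [seq k <- iota 0 #|T|.+1 | [exists c : k.-tuple T, is_cycle c]].

Lemma girthP :
  match girth with
  | Some k => (exists2 c, is_cycle c & size c = k)
              /\ (forall c, is_cycle c -> k <= size c)
  | None => forall c, ~~ is_cycle c
  end.
Proof.
have mem_c c : is_cycle c -> size c \in
    [seq k <- iota 0 #|T|.+1 | [exists c : k.-tuple T, is_cycle c]].
  move=> cc; rewrite mem_filter mem_iota add0n ltnS leq0n /=; apply/andP; split.
    by apply/existsP; exists (in_tuple c).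
  by case/and3P: cc => _ _ /andP[_ /card_uniqP <-]; apply: max_card.
have: sorted leq
    [seq k <- iota 0 #|T|.+1 | [exists c : k.-tuple T, is_cycle c]].
  by apply: sorted_filter (iota_sorted _ _); apply: leq_trans.
rewrite /girth; case Ds: [seq k <- _ | _] => [|k s] /=.
  by move=> _ c; apply/negP => /mem_c; rewrite Ds.
rewrite path_sortedE => [/andP[/allP le_ks _]|]; last exact: leq_trans.
have: k \in k :: s by rewrite mem_head.
rewrite -Ds mem_filter => /andP[/existsP[c cc] _]; split.
  by exists c; rewrite ?size_tuple.
by move=> d /mem_c; rewrite Ds inE => /predU1P[-> // | /le_ks].
Qed.

End Girth.

Section CoMaximal.

Variables (gT : finGroupType) (G : {group gT}).

Definition comaximal : rel {group gT} :=
  fun H K => (H != K) && (H * K == G :> {set gT}).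

Lemma comaximal_sym : symmetric comaximal.
Proof.
move=> H K; rewrite /comaximal eq_sym; congr (_ && _).
by rewrite -(inj_eq invg_inj) invMg !invGid.
Qed.

Lemma comaximal_irrefl : irreflexive comaximal.
Proof. by move=> H; rewrite /comaximal eqxx. Qed.

Definition comaximal_graph : sgraph {group gT} :=
  SGraph [set H : {group gT} | (H :!=: 1) && (H \proper G)]
         comaximal_sym comaximal_irrefl.

Definition deleted_comaximal_graph : sgraph {group gT} :=
  del_isolated comaximal_graph.

(* [Zp n] is the additive group of integers mod n, here with n >= 2. *)
Definition isog_Zpa : Prop :=
  exists p a : nat, [/\ prime p, 1 <= a & G \isog Zp (p ^ a)%N].

Definition isog_Zpaq : Prop :=
  exists p q a : nat,
    [/\ prime p, prime q, p != q, 1 <= a & G \isog Zp (p ^ a * q)%N].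

Definition isog_Zpaqb : Prop :=
  exists p q a b : nat,
    [/\ prime p, prime q, p != q, 2 <= a /\ 2 <= b
      & G \isog Zp (p ^ a * q ^ b)%N].

End CoMaximal.

(* Main.v *)
Require Import Defs.
From HB Require Import structures.
From mathcomp Require Import all_boot all_fingroup all_algebra all_solvable.

Set Implicit Arguments.
Unset Strict Implicit.
Unset Printing Implicit Defensive.

Import GroupScope.

(** The co-maximality relation is governed by the maximal subgroups of [G].
    In a nilpotent group these are normal, so any two distinct ones have
    product [G]; three of them form a triangle.  A group with at most two
    maximal subgroups is cyclic, since it is not the union of two proper
    subgroups and an element outside every maximal subgroup generates
    ([girth_comaximal_noncyclic]).  A nilpotent group whose order has three
    prime divisors also has a triangle ([girth_comaximal_3primes]).  What
    remains are the cyclic groups of order [p ^ a * q ^ b] with [p != q].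

    In a cyclic group, [H * K = G] holds exactly when the least common multiple
    of [#|H|] and [#|K|] is [#|G|] ([mulg_cyclic_eq]).  Hence, when [#|G|] is
    [p ^ a * q ^ b], one end of every edge has order divisible by [p ^ a] and
    the other end has order divisible by [q ^ b]; no proper subgroup has both
    properties.  The graph is thus bipartite and has no triangle.  If
    [b <= 1], a proper subgroup of order divisible by [p ^ a] can only be the
    one of order [p ^ a], so the edges form a star.  If [a] and [b] are at
    least 2, both sides have at least two vertices, which gives a square. *)

(** * Cycles and girth in a simple graph *)

Section Graph.

Variables (T : finType) (Gr : sgraph T).

(** Each vertex of a cycle has its successor as a neighbour, so removing the
    isolated vertices destroys no cycle. *)
Lemma is_cycle_del_isolated : is_cycle (del_isolated Gr) =1 is_cycle Gr.
Proof.
move=> c; rewrite /is_cycle /=; case: ltnP => //= _.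
case: (boolP (ucycleb _ c)) => [/andP[cc _] | _]; last by rewrite !andbF.
rewrite !andbT; apply/allP/allP => Vc x xc; have := Vc x xc.
  by rewrite !inE => /andP[].
rewrite /= inE => -> /=; apply/existsP; exists (next c x).
by rewrite (next_cycle cc xc) andbT; apply: Vc; rewrite mem_next.
Qed.

Lemma girth_del_isolated : girth (del_isolated Gr) = girth Gr.
Proof.
congr ohead; apply: eq_filter => k; apply: eq_existsb => c.
exact: is_cycle_del_isolated.
Qed.

Lemma girth_eqSome c :
    is_cycle Gr c -> (forall d, is_cycle Gr d -> size c <= size d) ->
  girth Gr = Some (size c).
Proof.
move=> cc min_c; have := girthP Gr; case: (girth Gr) => [k | /(_ c)/negP//].
case=> -[d /min_c le_cd <-] /(_ c cc) le_dc.
by congr Some; apply/eqP; rewrite eqn_leq le_dc le_cd.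
Qed.

Lemma girth_eq3 x y z :
    [/\ x \in vertices Gr, y \in vertices Gr & z \in vertices Gr] ->
    [/\ adj Gr x y, adj Gr y z & adj Gr z x] ->
  girth Gr = Some 3.
Proof.
case=> Vx Vy Vz [xy yz zx].
have neq u v : adj Gr u v -> u != v.
  by move=> uv; apply: contraTneq uv => ->; rewrite (adj_irrefl Gr).
apply: (@girth_eqSome [:: x; y; z]); last by move=> d /and3P[].
rewrite /is_cycle /ucycleb /= !inE Vx Vy Vz xy yz zx negb_or.
by rewrite (neq _ _ xy) (neq _ _ yz) eq_sym (neq _ _ zx).
Qed.

(** Three consecutive vertices [x], [y], [z] of a cycle are distinct.  If [y] is
    the centre, the edge that leaves [z] avoids it; otherwise both [x] and [z]
    would have to be the centre. *)
Lemma girth_star v :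
    {in vertices Gr &, forall x y, adj Gr x y -> (x == v) || (y == v)} ->
  girth Gr = None.
Proof.
move=> star; have := girthP Gr; case: (girth Gr) => // k [[c + _] _].
case: c => [|x [|y [|z c]]] // /and3P[_ /and4P[Vx Vy Vz Vc]].
case/andP=> /= /and3P[xy yz zc].
rewrite !inE !negb_or => /and4P[/and3P[xDy xDz _] /andP[yDz yc] _ _].
have [w [Vw zw wDy]]: exists w, [/\ w \in vertices Gr, adj Gr z w & w != y].
  case: c zc yc Vc => [|w c] /= /andP[zw _]; first by exists x.
  by rewrite inE negb_or eq_sym => /andP[wDy _] /andP[Vw _]; exists w.
have [yv | yDv] := eqVneq y v.
  have := star _ _ Vz Vw zw.
  by rewrite -yv eq_sym (negPf yDz) (negPf wDy).
have := star _ _ Vx Vy xy; have := star _ _ Vy Vz yz.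
rewrite (negPf yDv) orbF /= => /eqP zv /eqP xv.
by rewrite xv zv eqxx in xDz.
Qed.

(** A 2-colouring excludes cycles of length 3, so a cycle of length 4 is then a
    shortest one. *)
Lemma girth_eq4 (col : pred T) x y z t :
    {in vertices Gr &, forall u v, adj Gr u v -> col u != col v} ->
    [/\ x \in vertices Gr, y \in vertices Gr, z \in vertices Gr
      & t \in vertices Gr] ->
    [/\ adj Gr x y, adj Gr y z, adj Gr z t & adj Gr t x] ->
    x != z -> y != t ->
  girth Gr = Some 4.
Proof.
move=> bip [Vx Vy Vz Vt] [xy yz zt tx] xDz yDt.
have neq u v : adj Gr u v -> u != v.
  by move=> uv; apply: contraTneq uv => ->; rewrite (adj_irrefl Gr).
apply: (@girth_eqSome [:: x; y; z; t]).
  rewrite /is_cycle /ucycleb /= !inE !negb_or Vx Vy Vz Vt xy yz zt tx xDz yDt.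
  by rewrite (neq _ _ xy) (neq _ _ yz) (neq _ _ zt) (eq_sym x t) (neq _ _ tx).
move=> [|u [|v [|w [|? ?]]]] // /and3P[_ /and4P[Vu Vv Vw _]].
case/andP=> /= /and4P[uv vw wu _] _.
have:= bip _ _ Vu Vv uv; have:= bip _ _ Vv Vw vw; have:= bip _ _ Vw Vu wu.
by case: (col u) (col v) (col w) => [] [] [].
Qed.

End Graph.

(** * Triangles *)

Section Triangle.

Variables (gT : finGroupType) (G : {group gT}).
Implicit Types H K L M N : {group gT}.

Lemma comaximal_mem_edge H K :
    H \proper G -> K \proper G -> H * K = G ->
  [/\ H \in vertices (comaximal_graph G), K \in vertices (comaximal_graph G)
    & adj (comaximal_graph G) H K].
Proof.
move=> pHG pKG defG; rewrite !inE /= /comaximal defG pHG pKG eqxx !andbT.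
split; apply/eqP=> eq1.
- by move: pKG; rewrite -defG eq1 mul1g properxx.
- by move: pHG; rewrite -defG eq1 mulg1 properxx.
- by move: pKG; rewrite -defG eq1 mulGid properxx.
Qed.

Lemma girth_comaximal_eq3 H K L :
    [/\ H \proper G, K \proper G & L \proper G] ->
    [/\ H * K = G, K * L = G & L * H = G] ->
  girth (comaximal_graph G) = Some 3.
Proof.
move=> [pH pK pL] [HK KL LH].
have [VH VK eHK] := comaximal_mem_edge pH pK HK.
have [_ VL eKL] := comaximal_mem_edge pK pL KL.
have [_ _ eLH] := comaximal_mem_edge pL pH LH.
exact: (@girth_eq3 _ _ H K L).
Qed.

Hypothesis nilG : nilpotent G.

(** In a nilpotent group a proper subgroup is smaller than its normaliser, which
    for a maximal subgroup leaves only [G]. *)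
Lemma nilpotent_maximal_normal M : maximal M G -> M <| G.
Proof.
case/maxgroupP=> pMG maxM; rewrite /normal proper_sub //=.
have pMN := nilpotent_proper_norm nilG pMG.
apply: contraLR pMN => nMG; rewrite (maxM 'N_G(M)%G) ?properxx //.
  by rewrite properE subsetIl subsetI subxx.
by rewrite subsetI proper_sub ?normG.
Qed.

Lemma nilpotent_maximal_mul M N :
  maximal M G -> maximal N G -> M :!=: N -> M * N = G.
Proof.
move=> maxM maxN MDN; have [pMG _] := maxgroupP maxM.
have [pNG maxN'] := maxgroupP maxN.
apply: mulg_normal_maximal (nilpotent_maximal_normal maxM) maxM _ _.
  exact: proper_sub.
by apply: contra MDN => sNM; rewrite (maxN' M pMG).
Qed.

(** Given maximal subgroups [M] and [N], with [x] in [N] outside [M] and [m] in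
    [M] outside [N], the element [m * x] is in neither, so a maximal subgroup
    containing it is a third one. *)
Lemma girth_comaximal_noncyclic :
  ~~ cyclic G -> girth (comaximal_graph G) = Some 3.
Proof.
move=> ncG.
have max_cycle x : x \in G -> exists2 M : {group gT}, maximal M G & x \in M.
  move=> Gx; have sxG: <[x]> \subset G by rewrite cycle_subG.
  have [defG | [M maxM]] := maximal_exists sxG.
    by rewrite -defG cycle_cyclic in ncG.
  by rewrite cycle_subG; exists M.
have [M maxM _] := max_cycle 1 (group1 G); have [pMG maxM'] := maxgroupP maxM.
have [sMG [x Gx notMx]] := properP pMG.
have [N maxN Nx] := max_cycle x Gx; have [pNG _] := maxgroupP maxN.
have [m Mm notNm]: exists2 m, m \in M & m \notin N.
  apply/subsetPn; apply: contra notMx => sMN.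
  by rewrite -(maxM' N pNG sMN).
have [L maxL Lmx] := max_cycle (m * x) (groupM (subsetP sMG m Mm) Gx).
have [pLG _] := maxgroupP maxL.
apply: (@girth_comaximal_eq3 M N L) => //.
split; apply: nilpotent_maximal_mul => //.
- by apply: contraNneq notMx => ->.
- by apply: contraNneq notNm => NL; rewrite -(groupMr m Nx) NL.
- by apply: contraNneq notMx => LM; rewrite -(groupMl x Mm) -LM.
Qed.

(** The Hall [p^']-subgroups for different [p] are co-maximal: that of [q]
    contains the Sylow [p]-subgroup, which complements that of [p]. *)
Lemma girth_comaximal_3primes p q r :
    [/\ p \in \pi(G), q \in \pi(G) & r \in \pi(G)] -> uniq [:: p; q; r] ->
  girth (comaximal_graph G) = Some 3.
Proof.
move=> [pG qG rG]; rewrite /= !inE negb_or andbT => /andP[/andP[pDq pDr] qDr].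
have prO s : s \in \pi(G) -> 'O_s^'(G) \proper G.
  move=> sG; rewrite properEneq pcore_sub andbT.
  apply: contraTneq sG => defG.
  have := pcore_pgroup s^' G; rewrite defG => /pgroupP s'G.
  apply/negP; rewrite mem_primes => /and3P[pr_s _ sG].
  by have := s'G s pr_s sG; rewrite !inE eqxx.
have mulO (s t : nat) : s != t -> 'O_s^'(G) * 'O_t^'(G) = G.
  move=> sDt; apply/eqP; rewrite eqEsubset mul_subG ?pcore_sub //=.
  have /dprodP[_ defG _ _] := nilpotent_pcoreC t nilG.
  rewrite -{1}defG; apply/mulSg/sub_pcore => u.
  by rewrite !inE => /eqP->; rewrite eq_sym.
apply: (girth_comaximal_eq3 (H := 'O_p^'(G)) (K := 'O_q^'(G)) (L := 'O_r^'(G))).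
  by split; apply: prO.
by split; apply: mulO => //; rewrite eq_sym.
Qed.

End Triangle.

(** * Cyclic groups *)

Section Cyclic.

Variables (gT : finGroupType) (G : {group gT}).
Hypothesis cycG : cyclic G.
Implicit Types H K : {group gT}.

(** For the direct implication, a generator is a product [h * k] of commuting
    factors, so its order divides any common multiple of [#|H|] and [#|K|];
    conversely the order of the subgroup [H * K] is such a multiple. *)
Lemma mulg_cyclic_eq H K :
    H \subset G -> K \subset G ->
  (H * K == G) = (#|G| %| lcmn #|H| #|K|).
Proof.
move=> sHG sKG; have abG := cyclic_abelian cycG.
have cHK: K \subset 'C(H).
  by apply: subset_trans (centS sHG); apply: subset_trans abG.
apply/eqP/idP => [defG | dvG].
  have [x defx] := cyclicP cycG; have: x \in H * K by rewrite defG defx cycle_id.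
  case/mulsgP=> h k Hh Kk defhk; rewrite defx -orderE order_dvdn defhk.
  rewrite expgMn; last by apply/commute_sym/(centsP cHK).
  have /eqP->: h ^+ lcmn #|H| #|K| == 1.
    by rewrite -order_dvdn (dvdn_trans (order_dvdG Hh)) ?dvdn_lcml.
  by rewrite mul1g -order_dvdn (dvdn_trans (order_dvdG Kk)) ?dvdn_lcmr.
rewrite -cent_joinEr //; apply/eqP; rewrite eqEcard join_subG sHG sKG.
rewrite dvdn_leq ?cardG_gt0 //; apply: dvdn_trans dvG _.
by rewrite dvdn_lcm !cardSg ?joing_subl ?joing_subr.
Qed.

Lemma cyclic_subgroup_exists n :
  n %| #|G| -> exists2 H : {group gT}, H \subset G & #|H| = n.
Proof.
have [x defG] := cyclicP cycG => dvn; exists <[x ^+ (#|G| %/ n)]>%G.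
  by rewrite /= defG cycleX.
have dvn': n %| #[x] by rewrite orderE -defG.
by rewrite -orderE defG -orderE orderXdiv ?dvdn_div // divnA // mulKn.
Qed.

Lemma pfactor_dvdn_lcm p e m n : prime p -> 0 < m -> 0 < n ->
  (p ^ e %| lcmn m n) = (p ^ e %| m) || (p ^ e %| n).
Proof.
move=> pr_p m_gt0 n_gt0.
by rewrite !pfactor_dvdn ?lcmn_gt0 ?m_gt0 // logn_lcm // leq_max.
Qed.

Lemma mulg_cyclic_pfactor p e H K :
    prime p -> p ^ e %| #|G| -> H \subset G -> K \subset G -> H * K = G ->
  (p ^ e %| #|H|) || (p ^ e %| #|K|).
Proof.
move=> pr_p dvG sHG sKG /eqP; rewrite mulg_cyclic_eq //.
by move/(dvdn_trans dvG); rewrite pfactor_dvdn_lcm.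
Qed.

(** Taking [d = 1] covers cyclic [p]-groups: the centre of the star is then [G]
    itself, which is no vertex, so there is no edge. *)
Lemma girth_comaximal_cyclic_star p a d :
    prime p -> (d == 1%N) || prime d -> #|G| = (p ^ a * d)%N ->
  girth (comaximal_graph G) = None.
Proof.
move=> pr_p pr_d oG.
have dvG: p ^ a %| #|G| by rewrite oG dvdn_mulr.
have [P sPG oP] := cyclic_subgroup_exists dvG.
have defP H : H \proper G -> p ^ a %| #|H| -> H == P.
  move=> pHG /dvdnP[e oH]; have sHG := proper_sub pHG.
  rewrite -val_eqE /= (eq_subG_cyclic cycG) // oP.
  have:= cardSg sHG; have:= proper_card pHG; rewrite oG oH.
  rewrite mulnC ltn_pmul2l ?expn_gt0 ?prime_gt0 // => lt_ed.
  rewrite dvdn_pmul2l ?expn_gt0 ?prime_gt0 // => dv_ed.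
  have [/eqP d1 | {}pr_d] := orP pr_d.
    by move: dv_ed; rewrite d1 dvdn1 => /eqP->; rewrite muln1.
  have [_ /(_ e dv_ed)/orP[/eqP-> | /eqP ed]] := primeP pr_d.
    by rewrite muln1.
  by rewrite ed ltnn in lt_ed.
apply: (girth_star (v := P)) => H K; rewrite !inE => /andP[_ pHG] /andP[_ pKG].
case/andP=> _ /eqP defG.
have:= mulg_cyclic_pfactor pr_p dvG (proper_sub pHG) (proper_sub pKG) defG.
by case/orP=> dv; rewrite (defP _ _ dv) ?orbT.
Qed.

(** The colour of [H] is whether [p ^ a] divides [#|H|]: of two co-maximal
    proper subgroups, each of [p ^ a] and [q ^ b] divides the order of exactly
    one, and no single order is divisible by both. *)
Lemma girth_comaximal_cyclic_square p q a b :
    prime p -> prime q -> p != q -> 2 <= a -> 2 <= b ->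
    #|G| = (p ^ a * q ^ b)%N ->
  girth (comaximal_graph G) = Some 4.
Proof.
move=> pr_p pr_q pDq a_ge2 b_ge2 oG.
have p_gt1 := prime_gt1 pr_p; have q_gt1 := prime_gt1 pr_q.
have copq: coprime (p ^ a) (q ^ b).
  by rewrite coprimeXl ?coprimeXr // prime_coprime // dvdn_prime2.
have dvp: p ^ a %| #|G| by rewrite oG dvdn_mulr.
have dvq: q ^ b %| #|G| by rewrite oG dvdn_mull.
have mulG H K : H \subset G -> K \subset G ->
    p ^ a %| #|H| -> q ^ b %| #|K| -> H * K = G.
  move=> sHG sKG pH qK; apply/eqP; rewrite mulg_cyclic_eq // oG Gauss_dvd //.
  by rewrite (dvdn_trans pH) ?dvdn_lcml ?(dvdn_trans qK) ?dvdn_lcmr.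
have not_both H : H \proper G -> p ^ a %| #|H| -> ~~ (q ^ b %| #|H|).
  move=> pHG pH; apply/negP=> qH; have:= proper_card pHG.
  by rewrite ltnNge dvdn_leq ?cardG_gt0 // oG Gauss_dvd ?pH.
have propG H : H \subset G -> #|H| < p ^ a * q ^ b -> H \proper G.
  by move=> sHG ltHG; rewrite properEcard sHG oG.
have pa_gt0: 0 < p ^ a by rewrite expn_gt0 prime_gt0.
have qb_gt0: 0 < q ^ b by rewrite expn_gt0 prime_gt0.
have [ltp1 ltq1]: p < p ^ a /\ q < q ^ b.
  by rewrite -{1}(expn1 p) -{1}(expn1 q) !ltn_exp2l.
(* The square joins the subgroups of orders p ^ a and p ^ a * q, on one side,
   to those of orders q ^ b and p * q ^ b, on the other; the larger subgroup
   on each side is proper because a and b are at least 2. *)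
have [H1 sH1 oH1] := cyclic_subgroup_exists dvp.
have [K1 sK1 oK1] := cyclic_subgroup_exists dvq.
have [H2 sH2 oH2] : exists2 H : {group gT}, H \subset G & #|H| = (p ^ a * q)%N.
  by apply: cyclic_subgroup_exists; rewrite oG dvdn_pmul2l // dvdn_exp // ltnW.
have [K2 sK2 oK2] : exists2 K : {group gT}, K \subset G & #|K| = (p * q ^ b)%N.
  by apply: cyclic_subgroup_exists; rewrite oG dvdn_pmul2r // dvdn_exp // ltnW.
have pH1: H1 \proper G by rewrite propG // oH1 ltn_Pmulr // (ltn_trans q_gt1).
have pH2: H2 \proper G by rewrite propG // oH2 ltn_pmul2l.
have pK1: K1 \proper G by rewrite propG // oK1 ltn_Pmull // (ltn_trans p_gt1).
have pK2: K2 \proper G by rewrite propG // oK2 ltn_pmul2r.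
have edge H K : H \proper G -> K \proper G -> p ^ a %| #|H| -> q ^ b %| #|K| ->
    [/\ H \in vertices (comaximal_graph G), K \in vertices (comaximal_graph G)
      & adj (comaximal_graph G) H K].
  by move=> pHG pKG pH qK; apply: comaximal_mem_edge; rewrite // mulG ?proper_sub.
have dvH1: p ^ a %| #|H1| by rewrite oH1.
have dvH2: p ^ a %| #|H2| by rewrite oH2 dvdn_mulr.
have dvK1: q ^ b %| #|K1| by rewrite oK1.
have dvK2: q ^ b %| #|K2| by rewrite oK2 dvdn_mull.
have [VH1 VK1 e11] := edge H1 K1 pH1 pK1 dvH1 dvK1.
have [VH2 VK2 e22] := edge H2 K2 pH2 pK2 dvH2 dvK2.
have [_ _ e12] := edge H1 K2 pH1 pK2 dvH1 dvK2.
have [_ _ e21] := edge H2 K1 pH2 pK1 dvH2 dvK1.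
pose col (H : {group gT}) := p ^ a %| #|H|.
apply: (girth_eq4 (col := col) (x := H1) (y := K1) (z := H2) (t := K2)).
- move=> H K; rewrite !inE => /andP[_ pHG] /andP[_ pKG] /andP[_ /eqP defG].
  have [sHG sKG] := (proper_sub pHG, proper_sub pKG); rewrite /col.
  have:= mulg_cyclic_pfactor pr_p dvp sHG sKG defG.
  have:= mulg_cyclic_pfactor pr_q dvq sHG sKG defG.
  have [pH | _] := boolP (p ^ a %| #|H|); last by move=> _ /= ->.
  rewrite (negPf (not_both H pHG pH)) /= => qK _.
  by apply/eqP=> /esym pK; have:= not_both K pKG pK; rewrite qK.
- by [].
- by split=> //; rewrite adj_sym.
- apply/eqP=> eqH; have:= oH2; rewrite -eqH oH1 -{1}(muln1 (p ^ a)%N) => /eqP.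
  by rewrite eqn_pmul2l // => /eqP q1; rewrite -q1 in q_gt1.
apply/eqP=> eqK; have:= oK2; rewrite -eqK oK1 -{1}(mul1n (q ^ b)%N) => /eqP.
by rewrite eqn_pmul2r // => /eqP p1; rewrite -p1 in p_gt1.
Qed.


End Cyclic.

(** * The girth *)

Lemma isog_Zp (gT : finGroupType) (G : {group gT}) n :
  0 < n -> G \isog Zp n <-> cyclic G /\ #|G| = n.
Proof.
have cycZ: cyclic (Zp n).
  by rewrite /Zp; case: ifP => _; rewrite ?cyclic1 // Zp_cycle cycle_cyclic.
move=> n_gt0; split=> [isoG | [cycG oG]].
  by rewrite (isog_cyclic isoG) (card_isog isoG) card_Zp.
by rewrite isog_cyclic_card // cycZ card_Zp // oG /=.
Qed.

Theorem theorem3p8 (gT : finGroupType) (G : {group gT}) :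
  nilpotent G -> G :!=: 1 ->
  [/\ (isog_Zpa G \/ isog_Zpaq G) ->
        girth (deleted_comaximal_graph G) = None,
      isog_Zpaqb G ->
        girth (deleted_comaximal_graph G) = Some 4
    & ~ (isog_Zpa G \/ isog_Zpaq G) -> ~ isog_Zpaqb G ->
        girth (deleted_comaximal_graph G) = Some 3].
Proof.
move=> nilG ntG; rewrite /deleted_comaximal_graph girth_del_isolated.
have pf_gt0 p e : prime p -> 0 < p ^ e by move=> pr_p; rewrite expn_gt0 prime_gt0.
split.
- case=> [[p [a [pr_p _]]] | [p [q [a [pr_p pr_q _ _]]]]].
    case/isog_Zp=> [|cycG oG]; first exact: pf_gt0.
    apply: (girth_comaximal_cyclic_star cycG (d := 1%N) pr_p _ _) => //.
    by rewrite muln1; exact: oG.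
  case/isog_Zp=> [|cycG oG]; first by rewrite muln_gt0 pf_gt0 ?prime_gt0.
  by apply: (girth_comaximal_cyclic_star cycG pr_p _ oG); rewrite pr_q orbT.
- case=> p [q [a [b [pr_p pr_q pDq [a_ge2 b_ge2]]]]].
  case/isog_Zp=> [|cycG oG]; first by rewrite muln_gt0 !pf_gt0.
  exact: (girth_comaximal_cyclic_square cycG pr_p pr_q pDq a_ge2 b_ge2 oG).
move=> not12 not3; have [cycG | ] := boolP (cyclic G); last first.
  exact: girth_comaximal_noncyclic.
have pi_pos p : p \in primes #|G| -> prime p /\ 0 < logn p #|G|.
  by move=> p_pi; rewrite logn_gt0; move: p_pi (p_pi); rewrite {1}mem_primes => /andP[].
have := prod_prime_decomp (cardG_gt0 G); rewrite prime_decompE big_map.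
have := primes_uniq #|G|.
case def_pi: (primes #|G|) pi_pos => [|p [|q [|r s]]] pi_pos uniq_pi oG.
- by case/eqP: ntG; apply: card1_trivg; rewrite oG big_nil.
- have [pr_p a_gt0] := pi_pos p (mem_head _ _).
  case: not12; left; exists p, (logn p #|G|); split=> //.
  by apply/isog_Zp; rewrite ?pf_gt0 //; split=> //; rewrite {1}oG big_seq1.
- have [pr_p a_gt0] := pi_pos p (mem_head _ _).
  have [pr_q b_gt0]: prime q /\ 0 < logn q #|G|.
    by apply: pi_pos; rewrite !inE eqxx orbT.
  rewrite /= inE andbT in uniq_pi.
  move: oG a_gt0 b_gt0; rewrite big_cons big_seq1 /=.
  move: (logn p _) (logn q _) => a b oG a_gt0 b_gt0.
  have [a1 | aD1] := eqVneq a 1%N.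
    case: not12; right; exists q, p, b; split; rewrite 1?eq_sym //.
    apply/isog_Zp; first by rewrite muln_gt0 pf_gt0 ?prime_gt0.
    by split=> //; rewrite oG a1 mulnC.
  have [b1 | bD1] := eqVneq b 1%N.
    case: not12; right; exists p, q, a; split=> //.
    apply/isog_Zp; first by rewrite muln_gt0 pf_gt0 ?prime_gt0.
    by split=> //; rewrite oG b1.
  case: not3; exists p, q, a, b; split=> //.
    by rewrite (ltn_neqAle 1 a) (ltn_neqAle 1 b) eq_sym aD1 eq_sym bD1.
  by apply/isog_Zp; rewrite ?muln_gt0 ?pf_gt0.
apply: (girth_comaximal_3primes nilG (p := p) (q := q) (r := r)).
  have pi_mem u : u \in [:: p, q, r & s] -> u \in \pi(G) by rewrite -def_pi.
  by split; apply: pi_mem; rewrite !inE eqxx ?orbT.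
by move: uniq_pi; rewrite /= !inE !negb_or => /and3P[/and3P[-> -> _] /andP[-> _] _].
Qed.
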